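(* Let $\alpha,\beta,\gamma,\delta\in(0,\pi)$ with $\gamma=\alpha$, $\delta=\beta$, $\beta\neq\alpha$, $\alpha+\beta\neq\pi$ (an ''isogram''). Then the configuration space of the spherical 4-bar linkage with sector angles $\alpha,\beta,\gamma,\delta$ is the union of the following two branches, each diffeomorphic to a circle $S^1$: the set of all $$(x,y,z,w)=\left(t,\ \frac{\cos\frac{\alpha+\beta}{2}}{t\cos\frac{\alpha-\beta}{2}},\ t,\ \frac{\cos\frac{\beta+\alpha}{2}}{t\cos\frac{\beta-\alpha}{2}}\right),\quad t\in\mathbb{R}\cup\{\infty\},$$ and the set of all $$(x,y,z,w)=\left(t,\ \frac{\sin\frac{\alpha+\beta}{2}}{t\sin\frac{\alpha-\beta}{2}},\ -t,\ \frac{\sin\frac{\beta+\alpha}{2}}{t\sin\frac{\beta-\alpha}{2}}\right),\quad t\in\mathbb{R}\cup\{\infty\}.$$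
   Context: A configuration of the spherical 4-bar linkage (degree-4 single-vertex rigid origami) with sector angles $\alpha,\beta,\gamma,\delta\in(0,\pi)$ is a quadruple of folding angles $(\rho_x,\rho_y,\rho_z,\rho_w)\in(\mathbb{R}/2\pi\mathbb{Z})^4$ satisfying the closure condition $$R_3(\alpha)R_1(\rho_x)R_3(\beta)R_1(\rho_y)R_3(\gamma)R_1(\rho_z)R_3(\delta)R_1(\rho_w)=I,$$ where $R_1(\theta),R_3(\theta)\in SO(3)$ are the rotations by $\theta$ about the first and third coordinate axes. (Panel $\alpha$ lies between creases $w$ and $x$, $\beta$ between $x$ and $y$, $\gamma$ between $y$ and $z$, $\delta$ between $z$ and $w$.) Configurations are recorded by $x=\tan(\rho_x/2)$, $y=\tan(\rho_y/2)$, $z=\tan(\rho_z/2)$, $w=\tan(\rho_w/2)$ in $\mathbb{R}\cup\{\infty\}$, the one-point compactification (a folding angle $\pi$ corresponds to $\infty$; $-\infty$ and $\infty$ are identified), which is identified as a smooth manifold with the circle $\mathbb{R}/2\pi\mathbb{Z}$. The configuration space is the set of all such $(x,y,z,w)\in(\mathbb{R}\cup\{\infty\})^4$. For $c\neq0$ real, $c/0=\infty$ and $c/\infty=0$. *)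

(* Defs.v *)
From mathcomp Require Import all_boot all_order all_algebra.
From mathcomp Require Import all_classical all_reals all_analysis.
Set Implicit Arguments.
Unset Strict Implicit.
Unset Printing Implicit Defensive.
Import Order.TTheory GRing.Theory Num.Theory.
Import numFieldNormedType.Exports.
Local Open Scope classical_set_scope.
Local Open Scope ring_scope.

Section Rotations.
Variable R : realType.

Definition mx_of_rows (s : seq (seq R)) : 'M[R]_3 :=
  \matrix_(i < 3, j < 3) nth 0 (nth [::] s i) j.

(* Rotations act on column vectors; a positive angle is counterclockwise. *)
Definition R1 (t : R) : 'M[R]_3 :=
  mx_of_rows [:: [:: 1;     0;       0];
                 [:: 0; cos t; - sin t];
                 [:: 0; sin t;   cos t]].

Definition R3 (t : R) : 'M[R]_3 :=
  mx_of_rows [:: [:: cos t; - sin t; 0];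
                 [:: sin t;   cos t; 0];
                 [::     0;       0; 1]].

End Rotations.

Section ExtendedReals.
Variable R : realType.

(* R \cup {oo}; the point at infinity is [None]. *)
Definition ext : Type := one_point_compactification R.

(* tan (rho / 2), with value oo exactly when rho is an odd multiple of pi.
   It is 2 pi-periodic and so represents a function on R / 2 pi Z. *)
Definition tan_half (rho : R) : ext :=
  if cos (rho / 2) == 0 then None else Some (tan (rho / 2)).

(* The representative in ]-pi, pi] of the inverse of [tan_half]. *)
Definition fold_angle (x : ext) : R :=
  if x is Some t then 2 * atan t else pi.

Lemma fold_angleK (x : ext) : tan_half (fold_angle x) = x.
Proof.
case: x => [t|]; rewrite /tan_half /fold_angle.
  rewrite mulrAC divff ?pnatr_eq0// mul1r atanK gt_eqF// cos_gt0_pihalf//.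
  by rewrite atan_gtNpi2 atan_ltpi2.
by rewrite cos_pihalf eqxx.
Qed.

Definition ext_opp (x : ext) : ext :=
  if x is Some t then Some (- t) else None.

(* x * d for d != 0, so that oo * d = oo. *)
Definition ext_mul (x : ext) (d : R) : ext :=
  if x is Some t then Some (t * d) else None.

(* c / x for c != 0, with c / 0 = oo and c / oo = 0. *)
Definition ext_div (c : R) (x : ext) : ext :=
  if x is Some t then (if t == 0 then None else Some (c / t)) else Some 0.

End ExtendedReals.

Section ConfigurationSpace.
Variable R : realType.

Definition closure_condition (alpha beta gamma delta rx ry rz rw : R) : Prop :=
  R3 alpha *m R1 rx *m R3 beta *m R1 ry *m
  R3 gamma *m R1 rz *m R3 delta *m R1 rw = 1%:M.

(* Folding angles in R / 2 pi Z are given by real representatives; the closure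
   condition and [tan_half] do not depend on their choice. *)
Definition configuration_space (alpha beta gamma delta : R) :
    set (ext R * ext R * ext R * ext R) :=
  [set q | exists rx ry rz rw : R,
     closure_condition alpha beta gamma delta rx ry rz rw /\
     q = (tan_half rx, tan_half ry, tan_half rz, tan_half rw)].

End ConfigurationSpace.

Section Smoothness.
Variable R : realType.

(* All partial derivatives of f of order at most k exist and are continuous
   at every point of the open set U. *)
Fixpoint Ck (m k : nat) (U : set 'rV[R]_m) (f : 'rV[R]_m -> R) : Prop :=
  (forall x, U x -> {for x, continuous f}) /\
  if k is k'.+1 then
    forall i : 'I_m,
      (forall x, U x -> derivable f x (delta_mx 0 i)) /\
      Ck k' U (fun x => 'D_(delta_mx 0 i) f x)
  else True.

(* A map on an arbitrary subset A of R^m is smooth if near every point of A it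
   agrees on A with a C^oo map defined on an open subset of R^m. *)
Definition smooth_on (m n : nat) (A : set 'rV[R]_m)
    (f : 'rV[R]_m -> 'rV[R]_n) : Prop :=
  forall a, A a ->
    exists (U : set 'rV[R]_m) (F : 'rV[R]_m -> 'rV[R]_n),
      [/\ open U, U a,
          forall (j : 'I_n) (k : nat), Ck k U (fun v => F v 0 j) &
          forall v, A v -> U v -> F v = f v].

Definition diffeomorphic (m n : nat) (A : set 'rV[R]_m) (B : set 'rV[R]_n) :
    Prop :=
  exists (f : 'rV[R]_m -> 'rV[R]_n) (g : 'rV[R]_n -> 'rV[R]_m),
    [/\ set_fun A B f, set_fun B A g,
        forall a, A a -> g (f a) = a, forall b, B b -> f (g b) = b &
        smooth_on A f /\ smooth_on B g].

Definition unit_circle : set 'rV[R]_2 :=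
  [set v | v 0 0 ^+ 2 + v 0 1 ^+ 2 = 1].

(* R \cup {oo} carries the smooth structure of R / 2 pi Z, itself embedded in
   R^2 by rho |-> (cos rho, sin rho). This realizes the product of four copies
   as a torus in R^8. *)
Definition torus_embedding (q : ext R * ext R * ext R * ext R) : 'rV[R]_8 :=
  let: (x, y, z, w) := q in
  \row_(i < 8) nth 0 [:: cos (fold_angle x); sin (fold_angle x);
                         cos (fold_angle y); sin (fold_angle y);
                         cos (fold_angle z); sin (fold_angle z);
                         cos (fold_angle w); sin (fold_angle w)] i.

Definition diffeomorphic_to_circle (B : set (ext R * ext R * ext R * ext R)) :
    Prop :=
  diffeomorphic (torus_embedding @` B) unit_circle.

End Smoothness.

Section IsogramBranches.
Variable R : realType.

Definition isogram_branch1 (alpha beta : R) :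
    set (ext R * ext R * ext R * ext R) :=
  [set q | exists t : ext R,
     q = (t,
          ext_div (cos ((alpha + beta) / 2))
                  (ext_mul t (cos ((alpha - beta) / 2))),
          t,
          ext_div (cos ((beta + alpha) / 2))
                  (ext_mul t (cos ((beta - alpha) / 2))))].

Definition isogram_branch2 (alpha beta : R) :
    set (ext R * ext R * ext R * ext R) :=
  [set q | exists t : ext R,
     q = (t,
          ext_div (sin ((alpha + beta) / 2))
                  (ext_mul t (sin ((alpha - beta) / 2))),
          ext_opp t,
          ext_div (sin ((beta + alpha) / 2))
                  (ext_mul t (sin ((beta - alpha) / 2))))].

End IsogramBranches.

(* Main.v *)
(* In half angles, each rotation is conjugation by a unit quaternion. The
   product over one half of the linkage is a unit quaternion Q(x, y), bilinear
   in the half-angle vectors (cos, sin) of x and y, and closure says that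
   Q(z, w) = +/- the conjugate of Q(x, y). Comparing coordinates, with
   nonvanishing sin alpha and sin beta, forces (z, w) = (x, y) and the real part
   of Q(x, y) to vanish, or (z, w) = (-x, -y) and its k-part to vanish; these
   are the two branches.

   On the circle (cos rho_x, sin rho_x), all coordinates of the embedded branch
   are quotients of affine functions. Quotients affine / affine^n are stable
   under partial derivatives, hence smooth, and the projection to the first
   circle is the inverse map. *)

Require Import Defs.
From mathcomp Require Import all_boot all_order all_algebra.
From mathcomp Require Import all_classical all_reals all_analysis.
From mathcomp Require Import ring lra.
Set Implicit Arguments.
Unset Strict Implicit.
Unset Printing Implicit Defensive.
Import Order.TTheory GRing.Theory Num.Theory.
Import numFieldNormedType.Exports.
Local Open Scope classical_set_scope.
Local Open Scope ring_scope.

(** * Rotations as conjugation by unit quaternions *)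

Section Quaternions.
Variable R : realType.
Implicit Types a b c d t : R.

(* The matrix of v |-> q v q^* for the quaternion q = a + b i + c j + d k. *)
Definition qmx a b c d : 'M[R]_3 := mx_of_rows
  [:: [:: a ^+ 2 + b ^+ 2 - c ^+ 2 - d ^+ 2; 2 * (b * c - a * d);
          2 * (b * d + a * c)];
      [:: 2 * (b * c + a * d); a ^+ 2 - b ^+ 2 + c ^+ 2 - d ^+ 2;
          2 * (c * d - a * b)];
      [:: 2 * (b * d - a * c); 2 * (c * d + a * b);
          a ^+ 2 - b ^+ 2 - c ^+ 2 + d ^+ 2]].

(** Composing conjugations multiplies quaternions: the entries on the right are the Hamilton
    product. *)
Lemma qmxM a b c d a' b' c' d' :
  qmx a b c d *m qmx a' b' c' d' =
  qmx (a * a' - b * b' - c * c' - d * d') (a * b' + b * a' + c * d' - d * c')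
      (a * c' - b * d' + c * a' + d * b') (a * d' + b * c' - c * b' + d * a').
Proof.
apply/matrixP => -[[|[|[|//]]] ?] -[[|[|[|//]]] ?];
  rewrite !mxE !big_ord_recl big_ord0 !mxE /=; ring.
Qed.

(** The kernel of the double cover of the rotation group is the pair of quaternions 1 and -1. *)
Lemma qmx_eq1 a b c d : a ^+ 2 + b ^+ 2 + c ^+ 2 + d ^+ 2 = 1 ->
  qmx a b c d = 1%:M <-> [/\ a ^+ 2 = 1, b = 0, c = 0 & d = 0].
Proof.
move=> n1; split=> [/matrixP E|[a1 -> -> ->]].
  (* Subtracted from the norm, these diagonal entries give c^2 + d^2 = 0 and b^2 + d^2 = 0. *)
  have := E 0 0; have := E 1 1; rewrite !mxE /= => E1 E0.
  have b0 : b = 0 by nra.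
  have c0 : c = 0 by nra.
  have d0 : d = 0 by nra.
  by split=> //; nra.
apply/matrixP => -[[|[|[|//]]] ?] -[[|[|[|//]]] ?]; rewrite !mxE /=; nra.
Qed.

(** The product of the two quaternions must be a sign [e], its real part; hence the second is [e]
    times the conjugate of the first. *)
Lemma qmxM_eq1 a b c d a' b' c' d' :
  a ^+ 2 + b ^+ 2 + c ^+ 2 + d ^+ 2 = 1 ->
  a' ^+ 2 + b' ^+ 2 + c' ^+ 2 + d' ^+ 2 = 1 ->
  qmx a b c d *m qmx a' b' c' d' = 1%:M <->
  exists2 e, e ^+ 2 = 1 &
    [/\ a' = e * a, b' = - e * b, c' = - e * c & d' = - e * d].
Proof.
move=> n1 n1'; rewrite qmxM qmx_eq1; last first.
  (* Euler's four-square identity: the norm is multiplicative. *)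
  transitivity ((a ^+ 2 + b ^+ 2 + c ^+ 2 + d ^+ 2) *
                (a' ^+ 2 + b' ^+ 2 + c' ^+ 2 + d' ^+ 2)); first by ring.
  by rewrite n1 n1' mulr1.
split=> [[]|[e e1 [-> -> -> ->]]].
  move=> e1 E1 E2 E3; eexists; first exact: e1.
  (* Multiply the product by the conjugate of a + b i + c j + d k. *)
  have M x y z w u : (a ^+ 2 + b ^+ 2 + c ^+ 2 + d ^+ 2) * x - u =
      y * (a * b' + b * a' + c * d' - d * c') +
      z * (a * c' - b * d' + c * a' + d * b') +
      w * (a * d' + b * c' - c * b' + d * a') -> x = u.
    by rewrite n1 mul1r E1 E2 E3 !mulr0 !addr0 => /subr0_eq.
  split.
  - by apply: (M _ b c d); ring.
  - by apply: (M _ a d (- c)); ring.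
  - by apply: (M _ (- d) a b); ring.
  - by apply: (M _ c (- b) a); ring.
split; try ring.
transitivity (e ^+ 2 * (a ^+ 2 + b ^+ 2 + c ^+ 2 + d ^+ 2) ^+ 2); first by ring.
by rewrite e1 n1 expr1n mulr1.
Qed.

Lemma R1_qmx t : R1 t = qmx (cos (t / 2)) (sin (t / 2)) 0 0.
Proof.
have -> : R1 t = R1 (t / 2 *+ 2) by congr R1; lra.
have n1 := cos2Dsin2 (t / 2).
apply/matrixP => -[[|[|[|//]]] ?] -[[|[|[|//]]] ?];
  rewrite !mxE /= ?cos_mulr2n ?sin_mulr2n; nra.
Qed.

Lemma R3_qmx t : R3 t = qmx (cos (t / 2)) 0 0 (sin (t / 2)).
Proof.
have -> : R3 t = R3 (t / 2 *+ 2) by congr R3; lra.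
have n1 := cos2Dsin2 (t / 2).
apply/matrixP => -[[|[|[|//]]] ?] -[[|[|[|//]]] ?];
  rewrite !mxE /= ?cos_mulr2n ?sin_mulr2n; nra.
Qed.

End Quaternions.

(** * Half-angle tangents in homogeneous form *)

Section TanHalf.
Variable R : realType.
Implicit Types (a b c d : R) (x : ext R).

Lemma sin_cos_neq0 a : cos a = 0 -> sin a != 0.
Proof.
move=> c0; have := cos2Dsin2 a; rewrite c0 => h; apply/eqP => s0; move: h.
by rewrite s0; lra.
Qed.

(** The extended tangent is the projective class of (cos, sin), so equality is the vanishing of a 2
    by 2 determinant, at oo as well. *)
Lemma tan_half_eq a b : tan_half a = tan_half b <->
  cos (a / 2) * sin (b / 2) = sin (a / 2) * cos (b / 2).
Proof.
rewrite /tan_half /tan; have [ca|ca] := eqVneq (cos (a / 2)) 0;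
  have [cb|cb] := eqVneq (cos (b / 2)) 0.
- by rewrite ca cb mul0r mulr0.
- split=> // /esym/eqP; rewrite ca mul0r mulf_eq0 (negPf cb) orbF.
  by rewrite (negPf (sin_cos_neq0 ca)).
- split=> // /eqP; rewrite cb mulr0 mulf_eq0 (negPf ca) /=.
  by rewrite (negPf (sin_cos_neq0 cb)).
- split=> [[]/eqP|h].
    by rewrite eqr_div// => /eqP h; rewrite h mulrC.
  by congr Some; apply/eqP; rewrite eqr_div// -h mulrC.
Qed.

Lemma tan_halfN a : tan_half (- a) = ext_opp (tan_half a).
Proof. by rewrite /tan_half mulNr cosN tanN; case: ifP. Qed.

(** Clearing denominators gives an equation, bilinear in the half-angle vectors, that also covers
    the values 0 and oo: there both sides reduce to sin (b/2) = 0 or cos (b/2) = 0. *)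
Lemma tan_half_div a b c d : c != 0 -> d != 0 ->
  tan_half b = ext_div c (ext_mul (tan_half a) d) <->
  cos (a / 2) * cos (b / 2) * c = sin (a / 2) * sin (b / 2) * d.
Proof.
move=> c0 d0; rewrite /tan_half /tan; have [ca|ca] := eqVneq (cos (a / 2)) 0.
  have sa := sin_cos_neq0 ca; rewrite ca !mul0r /=.
  have [cb|cb] := eqVneq (cos (b / 2)) 0.
    split=> // /esym/eqP; rewrite !mulf_eq0 (negPf sa) (negPf d0) orbF /=.
    by rewrite (negPf (sin_cos_neq0 cb)).
  split=> [[]/eqP|/esym/eqP].
    by rewrite mulf_eq0 invr_eq0 (negPf cb) orbF => /eqP ->; rewrite mulr0 mul0r.
  by rewrite !mulf_eq0 (negPf sa) (negPf d0) orbF /= => /eqP ->; rewrite mul0r.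
rewrite /= !mulf_eq0 invr_eq0 (negPf ca) (negPf d0) !orbF.
have [sa|sa] := eqVneq (sin (a / 2)) 0.
  rewrite sa !mul0r; have [cb|cb] := eqVneq (cos (b / 2)) 0.
    by rewrite cb mulr0 mul0r.
  by split=> // /eqP; rewrite !mulf_eq0 (negPf ca) (negPf c0) (negPf cb).
have [cb|cb] := eqVneq (cos (b / 2)) 0.
  split=> // /esym/eqP; rewrite cb mulr0 mul0r !mulf_eq0 (negPf sa) (negPf d0).
  by rewrite (negPf (sin_cos_neq0 cb)).
split=> [[] h|h].
  have -> : sin (b / 2) = sin (b / 2) / cos (b / 2) * cos (b / 2).
    by rewrite divfK.
  by rewrite h; field; rewrite ca sa d0.
congr Some; apply/eqP; rewrite eqr_div ?mulf_neq0 ?invr_neq0//; apply/eqP.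
transitivity (sin (a / 2) * sin (b / 2) * d / cos (a / 2)); first by ring.
by rewrite -h; field.
Qed.

End TanHalf.

(** * Smoothness of quotients of affine functions *)

Section Smoothness.
Variable R : realType.

(** An affine function is kept as its constant term and linear coefficients, so that numerators of
    derivatives can be written down explicitly. *)
Definition affine_map m (p : R * ('I_m -> R)) (v : 'rV[R]_m) : R :=
  p.1 + \sum_(i < m) p.2 i * v 0 i.

Lemma affine_map_continuous m (p : R * ('I_m -> R)) :
  continuous (affine_map p).
Proof.
move=> v; have : forall F : set_system 'rV[R]_m, Filter F ->
    (forall i, x 0 i @[x --> F] --> v 0 i) ->
    affine_map p x @[x --> F] --> affine_map p v.
  move=> F FF Fv; apply: cvgD; first exact: cvg_cst.
  apply: (@cvg_big R _ +%R 0 xpredT) => [|i _].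
    exact: (@add_continuous R^o).
  by apply: cvgM; [exact: cvg_cst|exact: Fv].
apply; first exact: (@nbhs_filter 'rV[R]_m).
by move=> i; exact: coord_continuous.
Qed.

(** The difference quotient is constantly [p.2 i] for nonzero h. *)
Lemma is_derive_affine_map m (p : R * ('I_m -> R)) v i :
  is_derive v (delta_mx 0 i) (affine_map p) (p.2 i).
Proof.
have E (h : R) :
    affine_map p (h *: delta_mx 0 i + v) - affine_map p v = h * p.2 i.
  rewrite /affine_map opprD addrACA subrr add0r -sumrB (bigD1 i)//=.
  rewrite !mxE !eqxx mulr1 big1 => [|j ji].
    by ring.
  by rewrite !mxE eqxx (negPf ji) mulr0 add0r subrr.
have H : (fun h => h^-1 *: ((affine_map p \o shift v) (h *: delta_mx 0 i) -
    affine_map p v)) @ 0^' --> p.2 i.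
  have c : (fun _ : R => p.2 i) @ 0^' --> p.2 i by exact: cvg_cst.
  refine (cvg_trans _ c); apply: near_eq_cvg.
  near=> h; rewrite /= E /GRing.scale /= mulKf//.
  by near: h; exact: nbhs_dnbhs_neq.
by split; [apply/cvg_ex; exists (p.2 i)|exact/cvg_lim].
Unshelve. all: end_near. Qed.

Lemma affine_fraction_continuous m (p d : R * ('I_m -> R)) n (v : 'rV[R]_m) :
  affine_map d v != 0 ->
  {for v, continuous (fun x => affine_map p x / affine_map d x ^+ n)}.
Proof.
move=> dv; apply: (@continuousM _ _ (affine_map p)
  (fun x => (affine_map d x ^+ n)^-1)).
  exact: affine_map_continuous.
apply: (@continuousV _ _ (fun x => affine_map d x ^+ n)).
  by rewrite expf_neq0.
apply: (@continuous_comp _ _ _ (affine_map d) (fun y => y ^+ n)).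
  exact: affine_map_continuous.
exact: exprn_continuous.
Qed.

(** Induction on k with n, p and f free: differentiating raises the exponent of the same denominator
    and keeps the numerator affine. Agreement of f with the quotient is asked only on U, because the
    derivative is computed only there. *)
Lemma Ck_affine_fraction m (U : set 'rV[R]_m) (d : R * ('I_m -> R)) :
  open U -> (forall v, U v -> affine_map d v != 0) ->
  forall k n p (f : 'rV[R]_m -> R),
    (forall v, U v -> f v = affine_map p v / affine_map d v ^+ n) -> Ck k U f.
Proof.
move=> oU dU; elim=> [|k IH] n p f fE.
(* As U is open, equality on U holds near each point, so limits and derivatives carry over to f. *)
all: have near_fE v : U v ->
  \forall x \near v, affine_map p x / affine_map d x ^+ n = f x.
  1,3: by move=> Uv; near=> x; rewrite fE//; near: x; exact: open_nbhs_nbhs.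
all: have f_cont : forall v, U v -> {for v, continuous f}.
  1,3: move=> v Uv; rewrite /prop_for /continuous_at fE//.
  1,2: refine (cvg_trans (near_eq_cvg (near_fE v Uv)) _).
  1,2: exact: affine_fraction_continuous (dU v Uv).
- by [].
split=> // i.
(* d_i (p / d^n) = (p_i d - n d_i p) / d^(n+1) has again an affine numerator. *)
pose p' : R * ('I_m -> R) := (p.2 i * d.1 - n%:R * d.2 i * p.1,
   fun j => p.2 i * d.2 j - n%:R * d.2 i * p.2 j).
have p'E v : affine_map p' v =
    p.2 i * affine_map d v - n%:R * d.2 i * affine_map p v.
  rewrite /affine_map /p' /= !mulrDr !mulr_sumr opprD addrACA -sumrB.
  by congr (_ + _); apply: eq_bigr => j _; ring.
have fD v : U v ->
    is_derive v (delta_mx 0 i) f (affine_map p' v / affine_map d v ^+ n.+1).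
  move=> Uv; apply: (near_eq_is_derive (near_fE v Uv)).
  have dv := dU v Uv.
  have dD := @is_derive_affine_map m d v i.
  have pD := @is_derive_affine_map m p v i.
  have dnD := @is_deriveX _ _ _ n _ _ _ dD.
  have dn0 : (affine_map d ^+ n) v != 0 by rewrite fctE expf_neq0.
  have VD : is_derive v (delta_mx 0 i) (fun x => ((affine_map d ^+ n) x)^-1)
      (- ((affine_map d ^+ n) v) ^- 2 *:
       ((n%:R * affine_map d v ^+ n.-1) *: d.2 i)).
    apply: DeriveDef; first by apply: derivableV => //; case: dnD.
    by rewrite deriveV//; congr (_ *: _); case: dnD.
  have := is_deriveM pD VD; rewrite !fctE => /is_derive_eq; apply.
  rewrite p'E /GRing.scale /=.
  (* The derivative of d^n has the exponent [n.-1], truncated at n = 0; hence the case split. *)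
  by case: n {f fE near_fE f_cont p' p'E dnD VD dn0} => [|n] /=;
    rewrite ?expr0 ?exprS; field; rewrite ?expf_neq0 ?dv.
split=> [v Uv|]; first by case: (fD v Uv).
by apply: (IH n.+1 p') => v Uv; case: (fD v Uv).
Unshelve. all: end_near. Qed.

(** One open set, where none of the finitely many denominators vanishes, and one extension serve
    every point of A. *)
Lemma smooth_on_affine_fractions m n (A : set 'rV[R]_m)
    (f : 'rV[R]_m -> 'rV[R]_n) (p d : 'I_n -> R * ('I_m -> R)) :
  (forall v j, A v -> affine_map (d j) v != 0) ->
  (forall v j, A v -> f v 0 j = affine_map (p j) v / affine_map (d j) v) ->
  smooth_on A f.
Proof.
move=> dA fA a Aa.
pose U := [set v : 'rV[R]_m | forall j, affine_map (d j) v != 0].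
have oU : open U.
  rewrite openE => v Uv; rewrite /interior /U /=.
  apply: (@filter_forall _ _
    (fun j => [set x : 'rV[R]_m | affine_map (d j) x != 0])
    (nbhs (v : 'rV[R]_m)) (@nbhs_filter _ _)) => j.
  apply: (@affine_map_continuous m (d j) v [set y | y != 0]).
  apply: open_nbhs_nbhs; split; [exact: open_neq|exact: Uv].
exists U, (fun v => \row_j (affine_map (p j) v / affine_map (d j) v)).
split=> //.
- by move=> j; exact: dA.
- move=> j k; apply: (@Ck_affine_fraction _ U (d j) oU _ k 1%N (p j)).
    by move=> v /(_ j).
  by move=> v _; rewrite mxE expr1.
- by move=> v Av _; apply/rowP => j; rewrite mxE fA.
Qed.

End Smoothness.

(** * The circle in terms of the half-angle tangent *)

Section CircleCharts.
Variable R : realType.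
Implicit Types (t : ext R) (c d : R).

(** Inverse stereographic projection from (-1, 0), the image of oo. *)
Definition circle_point t : 'rV[R]_2 :=
  \row_i nth 0 [:: cos (fold_angle t); sin (fold_angle t)] i.

Lemma cos_fold_angle (t : R) :
  cos (fold_angle (Some t)) = (1 - t ^+ 2) / (1 + t ^+ 2).
Proof.
have t0 : 1 + t ^+ 2 != 0 :> R by rewrite gt_eqF// ltr_pwDl// sqr_ge0.
rewrite /= mulr_natl cos_mulr2n cos_atan exprVn sqr_sqrtr; last first.
  by rewrite addr_ge0// sqr_ge0.
by field.
Qed.

Lemma sin_fold_angle (t : R) :
  sin (fold_angle (Some t)) = 2 * t / (1 + t ^+ 2).
Proof.
have t0 : 1 + t ^+ 2 != 0 :> R by rewrite gt_eqF// ltr_pwDl// sqr_ge0.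
have c0 : cos (atan t) != 0.
  by rewrite gt_eqF// cos_gt0_pihalf// atan_gtNpi2 atan_ltpi2.
have sE : sin (atan t) = t * cos (atan t) by rewrite -{2}(atanK t) /tan divfK.
rewrite /= mulr_natl sin_mulr2n sE mulrCA -expr2 cos_atan exprVn sqr_sqrtr.
  by field.
by rewrite addr_ge0// sqr_ge0.
Qed.

(** A point v other than (-1, 0) has parameter sin / (1 + cos), its half-angle tangent. *)
Lemma unit_circleE : @unit_circle R = [set circle_point t | t in setT].
Proof.
rewrite eqEsubset; split=> [v|_ [t _ <-]]; rewrite /unit_circle /=; last first.
  by rewrite !mxE /= cos2Dsin2.
move=> v1; have vE t : cos (fold_angle t) = v 0 0 ->
    sin (fold_angle t) = v 0 1 -> circle_point t = v.
  move=> e0 e1; apply/rowP => -[[|[|//]] ?]; rewrite mxE /= ?e0 ?e1;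
    by congr (v _ _); apply/val_inj.
have [v0|v0] := eqVneq (1 + v 0 0) 0.
  by exists None => //; apply: vE; rewrite /= ?cospi ?sinpi; nra.
have q : 1 + (v 0 1 / (1 + v 0 0)) ^+ 2 = 2 / (1 + v 0 0).
  rewrite expr_div_n (_ : v 0 1 ^+ 2 = 1 - v 0 0 ^+ 2); last by lra.
  by field.
exists (Some (v 0 1 / (1 + v 0 0))) => //; apply: vE.
  rewrite cos_fold_angle (_ : 1 - _ = 2 - (1 + (v 0 1 / (1 + v 0 0)) ^+ 2)).
    by rewrite q; field; rewrite ?v0.
  by lra.
by rewrite sin_fold_angle q; field; rewrite ?v0.
Qed.

(** A single quotient represents [u] on the whole circle, so oo needs no second chart. *)
Definition circle_fraction (u : ext R -> R) : Prop :=
  exists p d : R * ('I_2 -> R), forall t,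
    affine_map d (circle_point t) != 0 /\
    u t = affine_map p (circle_point t) / affine_map d (circle_point t).

Lemma circle_fractionP (u : ext R -> R) (p0 p1 p2 d0 d1 d2 : R) :
  (forall t, let C := cos (fold_angle t) in let S := sin (fold_angle t) in
     d0 + d1 * C + d2 * S != 0 /\
     u t = (p0 + p1 * C + p2 * S) / (d0 + d1 * C + d2 * S)) ->
  circle_fraction u.
Proof.
move=> H.
exists (p0, fun i : 'I_2 => [:: p1; p2]`_i).
exists (d0, fun i : 'I_2 => [:: d1; d2]`_i) => t.
rewrite /affine_map !big_ord_recl !big_ord0 !mxE /= !addr0 !addrA.
exact: H.
Qed.

Lemma circle_fractionN (u : ext R -> R) :
  circle_fraction u -> circle_fraction (fun t => - u t).
Proof.
move=> [p [d pd]]; exists (- p.1, fun i => - p.2 i), d => t.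
have [d0 ->] := pd t; split=> //; rewrite -mulNr /affine_map opprD /= -sumrN.
by congr ((_ + _) / _); apply: eq_bigr => i _; rewrite mulNr.
Qed.

Lemma cos_fold_angle_circle_fraction :
  circle_fraction (fun t => cos (fold_angle t)).
Proof.
apply: (@circle_fractionP _ 0 1 0 1 0 0) => t /=.
by rewrite !mul0r !addr0 add0r oner_neq0 mul1r divr1.
Qed.

Lemma sin_fold_angle_circle_fraction :
  circle_fraction (fun t => sin (fold_angle t)).
Proof.
apply: (@circle_fractionP _ 0 0 1 1 0 0) => t /=.
by rewrite !mul0r !addr0 add0r oner_neq0 mul1r divr1.
Qed.

Lemma cos_fold_angle_opp t : cos (fold_angle (ext_opp t)) = cos (fold_angle t).
Proof. by case: t => //= t; rewrite atanN mulrN cosN. Qed.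

Lemma sin_fold_angle_opp t :
  sin (fold_angle (ext_opp t)) = - sin (fold_angle t).
Proof. by case: t => [t|] /=; rewrite ?atanN ?mulrN ?sinN// sinpi oppr0. Qed.

(* tan (Y/2) = c / (d tan (X/2)), with tan^2 (X/2) = (1 - cos X) / (1 + cos X)
   and tan (X/2) = sin X / (1 + cos X). *)
Lemma fold_angle_div c d t : c != 0 -> d != 0 ->
  let X := fold_angle t in let Y := fold_angle (ext_div c (ext_mul t d)) in
  let D := d ^+ 2 * (1 - cos X) + c ^+ 2 * (1 + cos X) in
  [/\ D != 0, cos Y = (d ^+ 2 * (1 - cos X) - c ^+ 2 * (1 + cos X)) / D &
      sin Y = 2 * c * d * sin X / D].
Proof.
move=> c0 d0 X Y D.
have c2 : 0 < c ^+ 2 by rewrite exprn_even_gt0.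
have d2 : 0 < d ^+ 2 by rewrite exprn_even_gt0.
(* The nonnegative numbers 1 - cos X and 1 + cos X carry positive weights and are not both zero. *)
have D0 : D != 0.
  have := cos_geN1 X; have := cos_le1 X => X1 X2.
  rewrite gt_eqF// /D; have [->|X3] := eqVneq (cos X) 1; first by nra.
  have : cos X < 1 by rewrite lt_neqAle X3.
  nra.
split=> //; move: D0; rewrite /D {D} /X /Y {X Y}; case: t => [t|].
- have t0 : 1 + t ^+ 2 != 0 :> R by rewrite gt_eqF// ltr_pwDl// sqr_ge0.
  rewrite cos_fold_angle; have [->|tn0] := eqVneq t 0.
    rewrite /= mul0r eqxx /= cospi => _.
    by field; rewrite ?c0 ?oner_neq0 ?pnatr_eq0.
  rewrite /ext_mul /ext_div mulf_eq0 (negPf tn0) (negPf d0) /= => _.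
  rewrite -/(fold_angle (Some (c / (t * d)))) cos_fold_angle.
  have u0 : (t * d) ^+ 2 + c ^+ 2 != 0.
    by rewrite gt_eqF// ltr_wpDl// sqr_ge0.
  by field; rewrite ?u0 ?t0 ?c0 ?d0 ?tn0; nra.
- rewrite /= cospi atan0 mulr0 cos0 => _.
  by field; rewrite ?d0 ?pnatr_eq0.
- have t0 : 1 + t ^+ 2 != 0 :> R by rewrite gt_eqF// ltr_pwDl// sqr_ge0.
  rewrite cos_fold_angle sin_fold_angle; have [->|tn0] := eqVneq t 0.
    by rewrite /= mul0r eqxx /= sinpi !(mulr0, mul0r).
  rewrite /ext_mul /ext_div mulf_eq0 (negPf tn0) (negPf d0) /= => _.
  rewrite -/(fold_angle (Some (c / (t * d)))) sin_fold_angle.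
  have u0 : (t * d) ^+ 2 + c ^+ 2 != 0.
    by rewrite gt_eqF// ltr_wpDl// sqr_ge0.
  by field; rewrite ?u0 ?t0 ?c0 ?d0 ?tn0; nra.
- by rewrite /= cospi sinpi atan0 mulr0 sin0 !(mulr0, mul0r).
Qed.

Lemma cos_fold_angle_div_circle_fraction c d : c != 0 -> d != 0 ->
  circle_fraction (fun t => cos (fold_angle (ext_div c (ext_mul t d)))).
Proof.
move=> c0 d0.
(* Coefficients of 1, cos X and sin X collected from [fold_angle_div]. *)
apply: (@circle_fractionP _ (d ^+ 2 - c ^+ 2) (- d ^+ 2 - c ^+ 2) 0
  (d ^+ 2 + c ^+ 2) (c ^+ 2 - d ^+ 2) 0) => t /=.
have [D0 cE _] := fold_angle_div t c0 d0; split.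
  by apply: contra_neq D0 => <-; ring.
by rewrite cE; congr (_ / _); ring.
Qed.

Lemma sin_fold_angle_div_circle_fraction c d : c != 0 -> d != 0 ->
  circle_fraction (fun t => sin (fold_angle (ext_div c (ext_mul t d)))).
Proof.
move=> c0 d0; apply: (@circle_fractionP _ 0 0 (2 * c * d)
  (d ^+ 2 + c ^+ 2) (c ^+ 2 - d ^+ 2) 0) => t /=.
have [D0 _ sE] := fold_angle_div t c0 d0; split.
  by apply: contra_neq D0 => <-; ring.
by rewrite sE; congr (_ / _); ring.
Qed.

(** As [phi t] starts with t, the first two of the eight coordinates recover the circle point. This
    projection and the map back, built from the chosen quotients, both fall under the affine
    quotient criterion. *)
Lemma diffeomorphic_to_circle_range
    (phi : ext R -> ext R * ext R * ext R * ext R) :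
  (forall t, (phi t).1.1.1 = t) ->
  (forall j, circle_fraction (fun t => torus_embedding (phi t) 0 j)) ->
  diffeomorphic_to_circle [set q | exists t, q = phi t].
Proof.
move=> phi1 /choice[p /choice[d pd]].
pose f (v : 'rV[R]_8) : 'rV[R]_2 := \row_i v 0 (widen_ord (isT : 2 <= 8)%N i).
pose g (v : 'rV[R]_2) : 'rV[R]_8 :=
  \row_j (affine_map (p j) v / affine_map (d j) v).
have fE t : f (torus_embedding (phi t)) = circle_point t.
  apply/rowP => i; rewrite !mxE; case: (phi t) (phi1 t) => [[[x y] z] w] /= ->.
  by rewrite mxE; case: i => -[|[|//]].
have gE t : g (circle_point t) = torus_embedding (phi t).
  by apply/rowP => j; rewrite mxE; case: (pd j t) => _ ->.
exists f, g; rewrite unit_circleE; split.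
- by move=> _ [_ [t ->] <-] /=; exists t => //; rewrite fE.
- by move=> _ [t _ <-] /=; exists (phi t); [exists t|rewrite gE].
- by move=> _ [_ [t ->] <-]; rewrite fE gE.
- by move=> _ [t _ <-]; rewrite gE fE.
split.
  apply: (@smooth_on_affine_fractions _ _ _ _ _
    (fun i => (0, fun j => (j == widen_ord (isT : 2 <= 8)%N i)%:R))
    (fun=> (1, fun=> 0))).
    move=> v j _; rewrite /affine_map /= big1 ?addr0 ?oner_neq0// => i _.
    by rewrite mul0r.
  move=> v j _; rewrite mxE /affine_map /= add0r.
  rewrite [X in _ / (1 + X)]big1 ?addr0 ?divr1 => [|i _]; last by rewrite mul0r.
  rewrite (bigD1 (widen_ord (isT : 2 <= 8)%N j))//= eqxx mul1r.
  rewrite big1 ?addr0// => i ij.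
  by rewrite (negPf ij) mul0r.
apply: (@smooth_on_affine_fractions _ _ _ _ _ p d).
  by move=> _ j [t _ <-]; case: (pd j t).
by move=> v j _; rewrite mxE.
Qed.

End CircleCharts.

(** * The isogram linkage and its two branches *)

Section Isogram.
Variables (R : realType) (alpha beta : R).
Hypotheses (halpha : 0 < alpha < pi) (hbeta : 0 < beta < pi).

Let Cp := cos ((alpha + beta) / 2).
Let Cm := cos ((alpha - beta) / 2).
Let Sp := sin ((alpha + beta) / 2).
Let Sm := sin ((alpha - beta) / 2).

(** Addition formulas gather the products of half sector angles into [Cp], [Cm], [Sp], [Sm]. *)
Lemma half_linkE x y : R3 alpha *m R1 x *m R3 beta *m R1 y =
  let cx := cos (x / 2) in let sx := sin (x / 2) in
  let cy := cos (y / 2) in let sy := sin (y / 2) in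
  qmx (Cp * (cx * cy) - Cm * (sx * sy)) (Cp * (cx * sy) + Cm * (sx * cy))
      (Sp * (cx * sy) + Sm * (sx * cy)) (Sp * (cx * cy) - Sm * (sx * sy)).
Proof.
rewrite !R1_qmx !R3_qmx !qmxM /=.
rewrite /Cp /Cm /Sp /Sm !mulrDl !mulNr cosD cosB sinD sinB.
by congr qmx; ring.
Qed.

Lemma half_link_unit (x y : R) :
  let cx := cos (x / 2) in let sx := sin (x / 2) in
  let cy := cos (y / 2) in let sy := sin (y / 2) in
  (Cp * (cx * cy) - Cm * (sx * sy)) ^+ 2 +
  (Cp * (cx * sy) + Cm * (sx * cy)) ^+ 2 +
  (Sp * (cx * sy) + Sm * (sx * cy)) ^+ 2 +
  (Sp * (cx * cy) - Sm * (sx * sy)) ^+ 2 = 1.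
Proof.
move=> cx sx cy sy.
transitivity (((Cp ^+ 2 + Sp ^+ 2) * cx ^+ 2 + (Cm ^+ 2 + Sm ^+ 2) * sx ^+ 2) *
              (cy ^+ 2 + sy ^+ 2)); first by ring.
by rewrite !cos2Dsin2 !mul1r cos2Dsin2 mulr1.
Qed.

(** Both halves have sector angles alpha, beta, hence the same quaternion function. [P] lists the
    entries of the tensor product of two half-angle vectors, in which that function is linear. *)
Lemma closure_isogramP x y z w :
  let P u v := (cos (u / 2) * cos (v / 2), sin (u / 2) * sin (v / 2),
                cos (u / 2) * sin (v / 2), sin (u / 2) * cos (v / 2)) in
  let: (p1, p2, p3, p4) := P x y in
  let: (q1, q2, q3, q4) := P z w in
  closure_condition alpha beta alpha beta x y z w <->
  exists2 e, e ^+ 2 = 1 &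
    [/\ Cp * q1 - Cm * q2 = e * (Cp * p1 - Cm * p2),
        Cp * q3 + Cm * q4 = - e * (Cp * p3 + Cm * p4),
        Sp * q3 + Sm * q4 = - e * (Sp * p3 + Sm * p4) &
        Sp * q1 - Sm * q2 = - e * (Sp * p1 - Sm * p2)].
Proof.
rewrite /= /closure_condition.
have -> : R3 alpha *m R1 x *m R3 beta *m R1 y *m
    R3 alpha *m R1 z *m R3 beta *m R1 w =
    (R3 alpha *m R1 x *m R3 beta *m R1 y) *m
    (R3 alpha *m R1 z *m R3 beta *m R1 w).
  by rewrite !mulmxA.
by rewrite !half_linkE; apply: qmxM_eq1; exact: half_link_unit.
Qed.

Lemma sin_half_sum_neq0 : Sp != 0.
Proof. by rewrite gt_eqF// sin_gt0_pi//; move: halpha hbeta; lra. Qed.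

Lemma cos_half_diff_neq0 : Cm != 0.
Proof. by rewrite gt_eqF// cos_gt0_pihalf//; move: halpha hbeta; lra. Qed.

Lemma cos_half_sum_neq0 : alpha + beta <> pi -> Cp != 0.
Proof.
move=> h; apply: contra_notN h => /eqP; rewrite -(cos_pihalf R).
have pi0 := pi_gt0 R.
move/cos_inj; rewrite !in_itv /= => H.
by have := H ltac:(move: halpha hbeta; lra) ltac:(lra); lra.
Qed.

Lemma sin_half_diff_neq0 : beta <> alpha -> Sm != 0.
Proof.
move=> h; apply: contra_notN h => /eqP; rewrite -[RHS](@sin0 R).
have pi0 := pi_gt0 R.
move/sin_inj; rewrite !in_itv /= => H.
by have := H ltac:(move: halpha hbeta; lra) ltac:(lra); lra.
Qed.

Hypotheses (hne : beta <> alpha) (hsum : alpha + beta <> pi).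

Let Cp0 : Cp != 0 := cos_half_sum_neq0 hsum.
Let Cm0 : Cm != 0 := cos_half_diff_neq0.
Let Sp0 : Sp != 0 := sin_half_sum_neq0.
Let Sm0 : Sm != 0 := sin_half_diff_neq0 hne.

(** The equations are linear in the tensor entries; the rank-one relations p1 p2 = p3 p4 and q1 q2 =
    q3 q4 make the system split into two cases. *)
Lemma closure_isogram_dichotomy p1 p2 p3 p4 q1 q2 q3 q4 e :
  p1 * p2 = p3 * p4 -> q1 * q2 = q3 * q4 -> e ^+ 2 = 1 ->
  Cp * q1 - Cm * q2 = e * (Cp * p1 - Cm * p2) ->
  Cp * q3 + Cm * q4 = - e * (Cp * p3 + Cm * p4) ->
  Sp * q3 + Sm * q4 = - e * (Sp * p3 + Sm * p4) ->
  Sp * q1 - Sm * q2 = - e * (Sp * p1 - Sm * p2) ->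
  [/\ q3 = - e * p3, q4 = - e * p4 &
      [/\ Sp * p1 = Sm * p2, q1 = e * p1 & q2 = e * p2] \/
      [/\ Cp * p1 = Cm * p2, q1 = - e * p1 & q2 = - e * p2]].
Proof.
move=> pp qq e1 E1 E2 E3 E4.
have sb : Sp * Cm - Cp * Sm = sin beta.
  by rewrite -sinB; congr sin; lra.
have sa : Sp * Cm + Cp * Sm = sin alpha.
  by rewrite -sinD; congr sin; lra.
have sb0 : sin beta != 0 by rewrite gt_eqF// sin_gt0_pi.
have sa0 : sin alpha != 0 by rewrite gt_eqF// sin_gt0_pi.
have e0 : e != 0 by rewrite -sqrf_eq0 e1 oner_neq0.
(* Cramer's rule for the two equations in q3 and q4, whose determinant is sin beta up to sign. *)
have q3E : q3 = - e * p3.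
  apply: (mulfI sb0); rewrite -sb.
  have -> : (Sp * Cm - Cp * Sm) * q3 =
    Cm * (Sp * q3 + Sm * q4) - Sm * (Cp * q3 + Cm * q4) by ring.
  by rewrite E2 E3; ring.
have q4E : q4 = - e * p4.
  apply: (mulfI sb0); rewrite -sb.
  have -> : (Sp * Cm - Cp * Sm) * q4 =
    Sp * (Cp * q3 + Cm * q4) - Cp * (Sp * q3 + Sm * q4) by ring.
  by rewrite E2 E3; ring.
split=> //.
(* [X], [Y] measure the failure of (q1, q2) = e (p1, p2), and [X'], [Y'] that of (q1, q2) = -e (p1,
   p2). The first and last equations relate the members of each pair. *)
pose X := q1 - e * p1; pose Y := q2 - e * p2.
pose X' := q1 + e * p1; pose Y' := q2 + e * p2.
have XY : Cp * X = Cm * Y by rewrite /X /Y; lra.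
have XY' : Sp * X' = Sm * Y' by rewrite /X' /Y'; lra.
have qp : q1 * q2 = p1 * p2.
  by rewrite qq q3E q4E pp mulrACA mulrNN -expr2 e1 mul1r.
have cross : X * Y' + X' * Y = 0.
  transitivity (2 * (q1 * q2 - e ^+ 2 * (p1 * p2))).
    by rewrite /X /Y /X' /Y'; ring.
  by rewrite qp e1; ring.
(* Multiplying [cross] by [Sp * Cp] and eliminating [X] and [X'] leaves this product, so one of the
   pairs vanishes. *)
have /eqP : sin alpha * (Y * Y') = 0.
  rewrite -sa.
  transitivity (Sp * (Cm * Y) * Y' + Cp * (Sm * Y') * Y); first by ring.
  by rewrite -XY -XY' -[RHS](mulr0 (Sp * Cp)) -cross; ring.
rewrite !mulf_eq0 (negPf sa0) /= => /orP[]/eqP Z.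
- have X0 : X = 0.
    by apply/eqP; move/eqP: XY; rewrite Z mulr0 mulf_eq0 (negPf Cp0).
  left; have q1E := subr0_eq X0; have q2E := subr0_eq Z; split=> //.
  by apply: (mulfI e0); move: E4; rewrite q1E q2E; lra.
- have X0 : X' = 0.
    by apply/eqP; move/eqP: XY'; rewrite Z mulr0 mulf_eq0 (negPf Sp0).
  right; have q1E : q1 = - e * p1 by move: X0; rewrite /X'; lra.
  have q2E : q2 = - e * p2 by move: Z; rewrite /Y'; lra.
  by split=> //; apply: (mulfI e0); move: E1; rewrite q1E q2E; lra.
Qed.

(** Proportional rank-one tensors have parallel factors: contract with the unit vector (cw, sw) for
    the first claim and with (cz, sz) for the second. *)
Lemma tensor_proportional (l cx sx cy sy cz sz cw sw : R) :
  cx ^+ 2 + sx ^+ 2 = 1 -> cy ^+ 2 + sy ^+ 2 = 1 ->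
  cz ^+ 2 + sz ^+ 2 = 1 -> cw ^+ 2 + sw ^+ 2 = 1 ->
  cz * cw = l * (cx * cy) -> sz * sw = l * (sx * sy) ->
  cz * sw = l * (cx * sy) -> sz * cw = l * (sx * cy) ->
  cx * sz = sx * cz /\ cy * sw = sy * cw.
Proof.
move=> x1 y1 z1 w1 E1 E2 E3 E4; split.
  transitivity (cx * ((sz * cw) * cw + (sz * sw) * sw)).
    by rewrite -!mulrA -!expr2 -mulrDr w1 mulr1.
  transitivity (sx * ((cz * cw) * cw + (cz * sw) * sw)).
    by rewrite E1 E2 E3 E4; ring.
  by rewrite -!mulrA -!expr2 -mulrDr w1 mulr1.
transitivity (cy * ((cz * sw) * cz + (sz * sw) * sz)).
  transitivity (cy * sw * (cz ^+ 2 + sz ^+ 2)); last by ring.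
  by rewrite z1 mulr1.
transitivity (sy * ((cz * cw) * cz + (sz * cw) * sz)).
  by rewrite E1 E2 E3 E4; ring.
transitivity (sy * cw * (cz ^+ 2 + sz ^+ 2)); first by ring.
by rewrite z1 mulr1.
Qed.

Lemma cos_half_diffC : cos ((beta - alpha) / 2) = Cm.
Proof. by rewrite /Cm -cosN; congr cos; lra. Qed.

Lemma sin_half_diffC : sin ((beta - alpha) / 2) = - Sm.
Proof. by rewrite /Sm -sinN; congr sin; lra. Qed.

Lemma ext_div_mulN (c d : R) (t : ext R) :
  ext_div c (ext_mul t (- d)) = ext_opp (ext_div c (ext_mul t d)).
Proof.
case: t => [t|] /=; last by rewrite oppr0.
by rewrite mulrN oppr_eq0; case: ifP => //= _; rewrite invrN mulrN.
Qed.

Lemma isogram_branch1E : isogram_branch1 alpha beta =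
  [set q | exists t, q = (t, ext_div Cp (ext_mul t Cm), t,
                          ext_div Cp (ext_mul t Cm))].
Proof. by rewrite /isogram_branch1 cos_half_diffC (addrC beta). Qed.

(** Sine is odd, so exchanging alpha and beta negates the denominator and w = -y here. *)
Lemma isogram_branch2E : isogram_branch2 alpha beta =
  [set q | exists t, q = (t, ext_div Sp (ext_mul t Sm), ext_opp t,
                          ext_opp (ext_div Sp (ext_mul t Sm)))].
Proof.
rewrite /isogram_branch2 sin_half_diffC (addrC beta).
by apply/seteqP; split=> q [t ->]; exists t; rewrite ext_div_mulN.
Qed.

Lemma configuration_space_isogram :
  configuration_space alpha beta alpha beta =
  isogram_branch1 alpha beta `|` isogram_branch2 alpha beta.
Proof.
rewrite isogram_branch1E isogram_branch2E; apply/seteqP; split.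
  move=> _ [x [y [z [w [/closure_isogramP[e e1 [E1 E2 E3 E4]] ->]]]]].
  have n (u : R) := cos2Dsin2 (u / 2).
  have [//||q3E q4E] := closure_isogram_dichotomy _ _ e1 E1 E2 E3 E4;
    [by ring|by ring|].
  case=> -[H q1E q2E]; [right|left]; exists (tan_half x); last first.
    (* First branch: all four entries are scaled by -e. *)
    have [zx wy] :=
      tensor_proportional (n x) (n y) (n z) (n w) q1E q2E q3E q4E.
    have -> : tan_half z = tan_half x by apply/esym/tan_half_eq.
    have -> : tan_half w = tan_half y by apply/esym/tan_half_eq.
    suff -> : tan_half y = ext_div Cp (ext_mul (tan_half x) Cm) by [].
    by apply/tan_half_div => //; rewrite mulrC H mulrC.
  (* Second branch: negating x and y changes the sign of the mixed entries only, so the q entries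
     are e times the tensor of -x and -y. *)
  have nN (u : R) : cos (u / 2) ^+ 2 + (- sin (u / 2)) ^+ 2 = 1 by rewrite sqrrN.
  have [||||zx wy] :=
    tensor_proportional (l := e) (nN x) (nN y) (n z) (n w).
  - exact: q1E.
  - by rewrite q2E; ring.
  - by rewrite q3E; ring.
  - by rewrite q4E; ring.
  have -> : tan_half z = ext_opp (tan_half x).
    by rewrite -tan_halfN; apply/esym/tan_half_eq; rewrite mulNr cosN sinN.
  have -> : tan_half w = ext_opp (tan_half y).
    by rewrite -tan_halfN; apply/esym/tan_half_eq; rewrite mulNr cosN sinN.
  suff -> : tan_half y = ext_div Sp (ext_mul (tan_half x) Sm) by [].
  by apply/tan_half_div => //; rewrite mulrC H mulrC.
move=> _ [] [t ->]; set u := ext_div _ _.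
- exists (fold_angle t), (fold_angle u), (fold_angle t), (fold_angle u).
  rewrite !fold_angleK; split=> //.
  have H : cos (fold_angle t / 2) * cos (fold_angle u / 2) * Cp =
           sin (fold_angle t / 2) * sin (fold_angle u / 2) * Cm.
    by apply/tan_half_div => //; rewrite !fold_angleK.
  (* Both halves give the same quaternion, purely imaginary by [H], hence minus its own
     conjugate. *)
  by apply/closure_isogramP; exists (-1); [ring|split; lra].
- exists (fold_angle t), (fold_angle u), (- fold_angle t), (- fold_angle u).
  rewrite !tan_halfN !fold_angleK; split=> //.
  have H : cos (fold_angle t / 2) * cos (fold_angle u / 2) * Sp =
           sin (fold_angle t / 2) * sin (fold_angle u / 2) * Sm.
    by apply/tan_half_div => //; rewrite !fold_angleK.
  (* Negating the angles flips the i and j parts; the k part vanishes by [H], so the result is the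
     conjugate and e = 1. *)
  apply/closure_isogramP; rewrite !mulNr !cosN !sinN.
  by exists 1; [ring|split; lra].
Qed.

Lemma isogram_branch1_circle :
  diffeomorphic_to_circle (isogram_branch1 alpha beta).
Proof.
have Y := cos_fold_angle_div_circle_fraction Cp0 Cm0.
have Y' := sin_fold_angle_div_circle_fraction Cp0 Cm0.
have X := @cos_fold_angle_circle_fraction R.
have X' := @sin_fold_angle_circle_fraction R.
rewrite isogram_branch1E; apply: (@diffeomorphic_to_circle_range _
  (fun t => (t, ext_div Cp (ext_mul t Cm), t, ext_div Cp (ext_mul t Cm)))) => // j.
have -> : (fun t : ext R => torus_embedding
    (t, ext_div Cp (ext_mul t Cm), t, ext_div Cp (ext_mul t Cm)) 0 j) =
  (fun t => nth 0 [:: cos (fold_angle t); sin (fold_angle t);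
     cos (fold_angle (ext_div Cp (ext_mul t Cm)));
     sin (fold_angle (ext_div Cp (ext_mul t Cm)));
     cos (fold_angle t); sin (fold_angle t);
     cos (fold_angle (ext_div Cp (ext_mul t Cm)));
     sin (fold_angle (ext_div Cp (ext_mul t Cm)))] j).
  by apply/funext => t; rewrite mxE.
by case: j => -[|[|[|[|[|[|[|[|//]]]]]]]] /= _.
Qed.

Lemma isogram_branch2_circle :
  diffeomorphic_to_circle (isogram_branch2 alpha beta).
Proof.
have Y := cos_fold_angle_div_circle_fraction Sp0 Sm0.
have Y' := sin_fold_angle_div_circle_fraction Sp0 Sm0.
have X := @cos_fold_angle_circle_fraction R.
have X' := @sin_fold_angle_circle_fraction R.
rewrite isogram_branch2E; apply: (@diffeomorphic_to_circle_range _
  (fun t => (t, ext_div Sp (ext_mul t Sm), ext_opp t,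
             ext_opp (ext_div Sp (ext_mul t Sm))))) => // j.
have -> : (fun t : ext R => torus_embedding
    (t, ext_div Sp (ext_mul t Sm), ext_opp t,
     ext_opp (ext_div Sp (ext_mul t Sm))) 0 j) =
  (fun t => nth 0 [:: cos (fold_angle t); sin (fold_angle t);
     cos (fold_angle (ext_div Sp (ext_mul t Sm)));
     sin (fold_angle (ext_div Sp (ext_mul t Sm)));
     cos (fold_angle t); - sin (fold_angle t);
     cos (fold_angle (ext_div Sp (ext_mul t Sm)));
     - sin (fold_angle (ext_div Sp (ext_mul t Sm)))] j).
  apply/funext => t; rewrite mxE.
  by rewrite !cos_fold_angle_opp !sin_fold_angle_opp.
(* The two negated sines come from z = -x and w = -y. *)
by case: j => -[|[|[|[|[|[|[|[|//]]]]]]]] /= _ //; exact: circle_fractionN.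
Qed.

End Isogram.

Unset Implicit Arguments.

Theorem mainTheorem7 (R : realType) (alpha beta gamma delta : R)
    (halpha : 0 < alpha < pi) (hbeta : 0 < beta < pi)
    (hgamma : 0 < gamma < pi) (hdelta : 0 < delta < pi)
    (hga : gamma = alpha) (hdb : delta = beta)
    (hne : beta <> alpha) (hsum : alpha + beta <> pi) :
  configuration_space alpha beta gamma delta =
    isogram_branch1 alpha beta `|` isogram_branch2 alpha beta /\
  diffeomorphic_to_circle (isogram_branch1 alpha beta) /\
  diffeomorphic_to_circle (isogram_branch2 alpha beta).
Proof.
subst gamma delta; split; first exact: configuration_space_isogram.
by split; [exact: isogram_branch1_circle|exact: isogram_branch2_circle].
Qed.
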